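(* Let $k$ be a field, let $t\le n$ be positive integers, and let $R=k[X_1,\dots,X_t]/I$ for some proper homogeneous ideal $I$ of $k[X_1,\dots,X_t]$. Let $X_{t+1},\dots,X_n$ be indeterminates. Then $$\operatorname{ms}(R[X_{t+1},\dots,X_n])=\operatorname{ms}(R)+n-t.$$
   Context: For a standard graded algebra $A=\bigoplus_{i\ge0}A_i$ over a field $k=A_0$ (so $A=A_0[A_1]$, Noetherian) with homogeneous maximal ideal $\mathfrak m=\bigoplus_{i\ge1}A_i$, put $\mu(J)=\dim_k(J/\mathfrak mJ)$ for a homogeneous ideal $J$, and define $$\operatorname{ms}(A)=\min\{\mu(J): J\subseteq\mathfrak m\text{ a homogeneous ideal of }A\text{ with }J\supseteq\mathfrak m^2\}.$$ Here $R$ and $R[X_{t+1},\dots,X_n]$ are standard graded with all variables in degree one. *)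

(* Defs.v *)
From HB Require Import structures.
From mathcomp Require Import all_boot all_order all_algebra.
From mathcomp Require Import ring_quotient.
From mathcomp Require Import boolp classical_sets.
From mathcomp Require Import mpoly.

Set Implicit Arguments.
Unset Strict Implicit.
Unset Printing Implicit Defensive.

Import GRing.Theory.
Local Open Scope ring_scope.
Local Open Scope classical_set_scope.

Definition finite_sums (V : nmodType) (E : set V) : set V :=
  [set x | exists2 s : seq V, (forall y, y \in s -> E y) & x = \sum_(y <- s) y].

Definition homogeneous (V : nmodType) (gr : nat -> set V) : set V :=
  [set x | exists d, gr d x].

Definition homogeneous_ideal (V : nmodType) (gr : nat -> set V) (J : set V) :=
  forall x, J x -> finite_sums (J `&` homogeneous gr) x.

(* [sg_gen] says at once that A = A_0[A_1] and that A is Noetherian, i.e. that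
   A is generated as a k-algebra by finitely many elements of degree one. *)
Record stdGradedAlg (k : fieldType) := StdGradedAlg {
  sg_ring :> comNzRingType;
  sg_emb : {rmorphism k -> sg_ring};
  sg_gr : nat -> set sg_ring;
  sg_gr_zmod : forall d,
    sg_gr d 0 /\ (forall x y, sg_gr d x -> sg_gr d y -> sg_gr d (x - y));
  sg_gr0 : sg_gr 0%N = range sg_emb;
  sg_grM : forall d e x y,
    sg_gr d x -> sg_gr e y -> sg_gr (d + e)%N (x * y);
  sg_span : forall x, finite_sums (homogeneous sg_gr) x;
  sg_direct : forall (n : nat) (f : nat -> sg_ring),
    (forall d, sg_gr d (f d)) -> \sum_(d < n) f d = 0 ->
    forall d, (d < n)%N -> f d = 0;
  sg_gen : exists (r : nat) (g : 'I_r -> sg_ring),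
    (forall i, sg_gr 1%N (g i)) /\
    (forall x, exists p : {mpoly k[r]}, x = mmap sg_emb g p)
}.

Section MinimalSquare.

Variables (k : fieldType) (A : stdGradedAlg k).

Definition irrelevant_ideal : set A :=
  finite_sums [set x | exists d, sg_gr d.+1 x].

Definition ideal_prod (J K : set A) : set A :=
  finite_sums [set z | exists x y, [/\ J x, K y & z = x * y]].

(* dim_k (U / W) = d: some d elements of U form a k-basis of U modulo W. *)
Definition has_quot_dim (U W : set A) (d : nat) :=
  exists b : 'I_d -> A,
    [/\ forall i, U (b i),
        forall x, U x ->
          exists c : 'I_d -> k, W (x - \sum_i sg_emb A (c i) * b i)
      & forall c : 'I_d -> k, W (\sum_i sg_emb A (c i) * b i) ->
          forall i, c i = 0].

(* The default value 0 would be used only if J / mJ had infinite dimension;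
   A being Noetherian, that does not happen for an ideal J. *)
Definition mu (J : set A) : nat :=
  xget 0%N (has_quot_dim J (ideal_prod irrelevant_ideal J)).

(* An [idealr] is a proper ideal; here J `<=` m makes J proper anyway.  It is a
   boolean predicate, which is no restriction in the presence of the classical
   axioms of boolp. *)
Definition ms_admissible (J : idealr A) :=
  [/\ homogeneous_ideal (@sg_gr k A) [set` J],
      [set` J] `<=` irrelevant_ideal
    & ideal_prod irrelevant_ideal irrelevant_ideal `<=` [set` J]].

(* The least element of {mu J | J admissible}, a nonempty set of naturals since
   it contains the value at the irrelevant ideal. *)
Definition ms : nat :=
  xget 0%N [set d | (exists2 J : idealr A, ms_admissible J & mu [set` J] = d) /\
                    (forall J : idealr A, ms_admissible J ->
                                          (d <= mu [set` J])%N)].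

End MinimalSquare.

Definition mpoly_gr (R : nzRingType) (t : nat) (d : nat) : set {mpoly R[t]} :=
  [set p | p \is d.-homog].

Section Quotient.

Variables (k : fieldType) (t : nat) (I : idealr {mpoly k[t]}).
Hypothesis I_hom : homogeneous_ideal (@mpoly_gr k t) [set` I].

Local Notation Q := {ideal_quot I}.
Local Notation piI := (\pi_Q%qT : {mpoly k[t]} -> Q).

Definition quot_gr (d : nat) : set Q := piI @` @mpoly_gr k t d.

Definition quot_emb : {rmorphism k -> Q} := piI \o @mpolyC t k.

Lemma quot_pi_eq0 p : piI p = 0 -> p \in I.
Proof.
move=> h; have : piI p = piI 0 by rewrite h raddf0.
by move/eqP; rewrite -Quotient.idealrBE subr0.
Qed.

Lemma quot_pi_surj (x : Q) : exists p, x = piI p.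
Proof. by exists (repr x); rewrite reprK. Qed.

Lemma quot_gr_zmod d :
  quot_gr d 0 /\ (forall x y, quot_gr d x -> quot_gr d y -> quot_gr d (x - y)).
Proof.
split; first by exists 0; [rewrite /mpoly_gr /= dhomog0 | rewrite raddf0].
move=> _ _ [p hp <-] [q hq <-]; exists (p - q); last by rewrite raddfB.
by rewrite /mpoly_gr /=; apply: rpredB.
Qed.

Lemma quot_gr0 : quot_gr 0%N = range quot_emb.
Proof.
apply/seteqP; split=> [_ [p hp <-]|_ [c _ <-]]; last first.
  exists c%:MP => //; rewrite /mpoly_gr /=; apply/dhomogP => m.
  rewrite msuppC; case: ifP => // _; rewrite mem_seq1 => /eqP ->; exact: mdeg0.
suff e : p = (p@_0%MM)%:MP by exists p@_0%MM; [|rewrite [in RHS]e].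
apply/mpolyP => m.
rewrite mcoeffC; case: eqP => [<-|/eqP m0]; first by rewrite mulr1.
by rewrite mulr0 (dhomog_nemf_coeff hp) // mdeg_eq0.
Qed.

Lemma quot_grM d e x y :
  quot_gr d x -> quot_gr e y -> quot_gr (d + e)%N (x * y).
Proof.
move=> [p hp <-] [q hq <-]; exists (p * q); last by rewrite rmorphM.
by rewrite /mpoly_gr /=; apply: dhomogM.
Qed.

Lemma quot_span x : finite_sums (homogeneous quot_gr) x.
Proof.
have [p ->] := quot_pi_surj x.
exists [seq piI (pihomog mdeg d p) | d <- iota 0 (msize p)].
  move=> y /mapP [d _ ->]; exists d; exists (pihomog mdeg d p) => //.
  by rewrite /mpoly_gr /=; apply: pihomogP.
rewrite {1}(pihomog_partitionE (leqnn (msize p))) raddf_sum big_map.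
by rewrite -(big_mkord xpredT (fun d => piI (pihomog mdeg d p))) /index_iota subn0.
Qed.

Lemma hom_ideal_pihomog p d : p \in I -> pihomog mdeg d p \in I.
Proof.
move=> /I_hom [s hs ->]; rewrite raddf_sum big_seq; apply: rpred_sum => q qs /=.
have [qI [e qe]] := hs _ qs; case: (eqVneq e d) => [<-|ne].
  by rewrite (pihomog_dE qe).
by rewrite (pihomog_ne0 ne qe) rpred0.
Qed.

Lemma quot_direct (n : nat) (f : nat -> Q) :
  (forall d, quot_gr d (f d)) -> \sum_(d < n) f d = 0 ->
  forall d, (d < n)%N -> f d = 0.
Proof.
move=> hf h0 d dn.
have /boolp.choice [g hg] i : exists p, p \is i.-homog /\ piI p = f i.
  by have [p] := hf i; exists p.
have ghom i : g i \is i.-homog by have [] := hg i.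
have gf i : f i = piI (g i) by have [] := hg i.
have : piI (\sum_(i < n) g i) = 0.
  by rewrite raddf_sum -[RHS]h0; apply: eq_bigr => i _; rewrite gf.
move=> /quot_pi_eq0 /(hom_ideal_pihomog d).
rewrite raddf_sum (bigD1 (Ordinal dn)) //= (pihomog_dE (ghom d)) big1 ?addr0.
  by move=> gI; rewrite gf -[RHS](raddf0 piI); apply/eqP; rewrite -Quotient.idealrBE subr0.
by move=> i ne; rewrite (pihomog_ne0 _ (ghom i)).
Qed.

Lemma quot_gen : exists (r : nat) (g : 'I_r -> Q),
  (forall i, quot_gr 1%N (g i)) /\
  (forall x, exists p : {mpoly k[r]}, x = mmap quot_emb g p).
Proof.
exists t, (fun i => piI 'X_i); split.
  by move=> i; exists 'X_i => //; rewrite /mpoly_gr /= dhomogX; apply/eqP/mdeg1.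
move=> x; have [p ->] := quot_pi_surj x; exists p.
rewrite {1}[p]mpolyE raddf_sum /mmap; apply: eq_bigr => m _.
rewrite -mul_mpolyC [LHS]rmorphM; congr (_ * _).
by rewrite mpolyXE_id rmorph_prod; apply: eq_bigr => i _; rewrite rmorphXn.
Qed.

Definition quotSGA : stdGradedAlg k :=
  StdGradedAlg quot_gr_zmod quot_gr0 quot_grM quot_span quot_direct quot_gen.

End Quotient.

Section Polynomials.

Variables (k : fieldType) (A : stdGradedAlg k) (m : nat).

(* Total degree: a homogeneous element of degree d is a sum of terms a X^u with
   a homogeneous in A and deg a + |u| = d. *)
Definition poly_gr (d : nat) : set {mpoly A[m]} :=
  [set p | forall u : 'X_{1..m},
     if (mdeg u <= d)%N then sg_gr (d - mdeg u) p@_u else p@_u = 0].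

Definition poly_emb : {rmorphism k -> {mpoly A[m]}} :=
  @mpolyC m A \o sg_emb A.

Lemma poly_gr_zmod d :
  poly_gr d 0 /\ (forall x y, poly_gr d x -> poly_gr d y -> poly_gr d (x - y)).
Proof.
split=> [u|p q hp hq u].
  by rewrite mcoeff0; case: ifP => // _; have [] := sg_gr_zmod A (d - mdeg u).
have := hq u; have := hp u; rewrite mcoeffB; case: ifP => _.
  by have [_] := sg_gr_zmod A (d - mdeg u); apply.
by move=> -> ->; rewrite subr0.
Qed.

Lemma sg_gr_sum d (J : Type) (s : seq J) (P : pred J) (F : J -> A) :
  (forall j, P j -> sg_gr d (F j)) -> sg_gr d (\sum_(j <- s | P j) F j).
Proof.
have [g0 gB] := sg_gr_zmod A d => hF; elim/big_ind: _ => // x y gx gy.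
by rewrite -[y]opprK; apply: (gB) => //; rewrite -sub0r; apply: gB.
Qed.

Lemma poly_gr0 : poly_gr 0%N = range poly_emb.
Proof.
apply/seteqP; split=> [p hp|_ [c _ <-] u]; last first.
  rewrite /= mcoeffC leqn0 mdeg_eq0 sub0n.
  by case: (eqVneq u 0%MM) => _; rewrite ?mulr0 // mulr1 sg_gr0; exists c.
have := hp 0%MM; rewrite mdeg0 leqnn subn0 sg_gr0 => -[c _ hc].
exists c => //=; apply/mpolyP => u; rewrite mcoeffC.
case: (eqVneq u 0%MM) => [->|u0]; first by rewrite mulr1.
by have := hp u; rewrite leqn0 mdeg_eq0 (negbTE u0) mulr0.
Qed.

Lemma poly_grM d e x y :
  poly_gr d x -> poly_gr e y -> poly_gr (d + e)%N (x * y).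
Proof.
move=> hx hy u; rewrite mcoeffM.
have key (v w : 'X_{1..m}) : u == (v + w)%MM ->
    (mdeg u <= d + e)%N /\ sg_gr ((d + e) - mdeg u) (x@_v * y@_w) \/
    x@_v * y@_w = 0.
  move=> /eqP ->; have := hy w; have := hx v.
  case: (leqP _ d) => hd; last by move=> ->; rewrite mul0r; right.
  case: (leqP _ e) => he; last by move=> _ ->; rewrite mulr0; right.
  move=> gx gy; left; rewrite mdegD leq_add //; split=> //.
  have -> : (d + e - (mdeg v + mdeg w) = (d - mdeg v) + (e - mdeg w))%N.
    by rewrite subnDA -addnBAC // -addnBA.
  exact: sg_grM.
case: ifP => hu.
  apply: sg_gr_sum => v /key [[_] //|->].
  by have [] := sg_gr_zmod A (d + e - mdeg u).
by apply: big1 => v /key [[]|->] //; rewrite hu.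
Qed.

Lemma poly_span x : finite_sums (homogeneous poly_gr) x.
Proof.
elim/mpolyind: x => [|c u p _ _ [s hs ->]]; first by exists [::]; rewrite ?big_nil.
have [r hr ->] := sg_span c.
exists ([seq y *: 'X_[u] | y <- r] ++ s); last first.
  by rewrite big_cat big_map scaler_suml.
move=> y; rewrite mem_cat => /orP[/mapP [z zr ->]|/hs //].
have [d gz] := hr _ zr; exists (d + mdeg u)%N => v.
rewrite mcoeffZ mcoeffX; case: (eqVneq u v) => [<-|_].
  by rewrite leq_addl addnK mulr1.
by rewrite mulr0; case: ifP => // _; have [] := sg_gr_zmod A (d + mdeg u - mdeg v).
Qed.

Lemma poly_direct (n : nat) (f : nat -> {mpoly A[m]}) :
  (forall d, poly_gr d (f d)) -> \sum_(d < n) f d = 0 ->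
  forall d, (d < n)%N -> f d = 0.
Proof.
move=> hf h0 d dn; apply/mpolyP => u; rewrite mcoeff0.
have := hf d u; case: (leqP _ d) => // ud _.
pose g i := (f (i + mdeg u)%N)@_u.
have hg i : sg_gr i (g i) by have := hf (i + mdeg u)%N u; rewrite leq_addl addnK.
have un : (mdeg u <= n)%N by apply: leq_trans ud (ltnW dn).
have := sg_direct (n := n - mdeg u) hg _ (d := d - mdeg u).
rewrite /g subnK // ltn_sub2rE // => -> //.
have /(congr1 (mcoeff u)) := h0; rewrite mcoeff0 raddf_sum /=.
rewrite -(big_mkord xpredT (fun i => (f i)@_u)) (big_cat_nat (leq0n _) un) //=.
rewrite big_nat_cond big1 ?add0r.
  by rewrite -{1}[mdeg u]add0n big_addn big_mkord.
by move=> i /andP[/andP[_ iu] _]; have := hf i u; rewrite leqNgt iu.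
Qed.

Lemma poly_gen : exists (r : nat) (g : 'I_r -> {mpoly A[m]}),
  (forall i, poly_gr 1%N (g i)) /\
  (forall x, exists p : {mpoly k[r]}, x = mmap poly_emb g p).
Proof.
have [r [g [g1 gen]]] := sg_gen A.
pose G (i : 'I_(r + m)) : {mpoly A[m]} :=
  match fintype.split i with inl j => (g j)%:MP | inr j => 'X_j end.
exists (r + m)%N, G; split.
  move=> i u; rewrite /G; case: fintype.split => j.
    rewrite mcoeffC; case: (eqVneq u 0%MM) => [->|u0].
      by rewrite mdeg0 subn0 mulr1; apply: g1.
    rewrite mulr0; case: ifP => // _; by have [] := sg_gr_zmod A (1 - mdeg u).
  rewrite mcoeffX; case: (eqVneq U_(j)%MM u) => [<-|_].
    rewrite mdeg1 subnn /= sg_gr0; exists 1 => //; exact: rmorph1.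
  by case: ifP => // _; have [] := sg_gr_zmod A (1 - mdeg u).
pose im (x : {mpoly A[m]}) := exists p : {mpoly k[r + m]}, x = mmap poly_emb G p.
have im0 : im 0 by exists 0; rewrite raddf0.
have im1 : im 1 by exists 1; rewrite rmorph1.
have imD x y : im x -> im y -> im (x + y).
  by move=> [p ->] [q ->]; exists (p + q); rewrite raddfD.
have imM x y : im x -> im y -> im (x * y).
  by move=> [p ->] [q ->]; exists (p * q); rewrite rmorphM.
have imX x i : im x -> im (x ^+ i).
  by move=> hx; elim: i => [|i IH]; rewrite ?expr0 // exprS; apply: imM.
have imG i : im (G i) by exists 'X_i; rewrite mmapX mmap1U.
have imk c : im ((sg_emb A c)%:MP) by exists c%:MP; rewrite mmapC.
have imA c : im c%:MP.
  have [p ->] := gen c; rewrite /mmap raddf_sum; elim/big_ind: _ => // u _.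
  rewrite /= mpolyCM; apply: (imM); first exact: imk.
  rewrite /mmap1 rmorph_prod; apply: (big_ind im im1 imM) => i _.
  rewrite rmorphXn.
  apply: imX; have := imG (lshift m i); rewrite /G.
  by rewrite -[lshift m i]/(unsplit (inl i)) unsplitK.
move=> x; elim/mpolyind: x => // c u p _ _ hp; apply: (imD) => //.
rewrite -mul_mpolyC; apply: (imM) => //; rewrite mpolyXE_id.
apply: (big_ind im im1 imM) => i _; apply: imX; have := imG (rshift r i); rewrite /G.
by rewrite -[rshift r i]/(unsplit (inr i)) unsplitK.
Qed.

Definition polySGA : stdGradedAlg k :=
  StdGradedAlg poly_gr_zmod poly_gr0 poly_grM poly_span poly_direct poly_gen.

End Polynomials.

(* Main.v *)
(* An admissible J is determined by V = J_1, and
   dim J/mJ = dim V + dim A_2/A_1V, so adjoining the new variables to J gives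
   ms(A[X_1..X_m]) <= ms(A) + m.  For the reverse inequality the variables are
   removed one at a time, the last one being X.  If an admissible J of
   B = C[X] contains a linear form f = X + a with a in C_1, the substitution
   X := -a maps J onto an admissible ideal J' of C and kills f; otherwise
   X := 0 does so with f = X^2.  In both cases f is nonzero in J/m_B J, and it
   lies in the kernel of J/m_B J -> J'/m_C J', so mu drops by at least one. *)
Require Import Defs.
From HB Require Import structures.
From mathcomp Require Import all_boot all_order all_algebra.
From mathcomp Require Import ring_quotient.
From mathcomp Require Import boolp classical_sets.
From mathcomp Require Import mpoly.

Set Implicit Arguments.
Unset Strict Implicit.
Unset Printing Implicit Defensive.

Import GRing.Theory.
Local Open Scope ring_scope.
Local Open Scope classical_set_scope.

(** * Finite sums, and ideals as sets *)

Section FiniteSums.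

Variables (V : nmodType) (E : set V).

Lemma finite_sums0 : finite_sums E 0.
Proof. by exists [::]; rewrite ?big_nil. Qed.

Lemma finite_sums_incl x : E x -> finite_sums E x.
Proof.
move=> Ex; exists [:: x]; last by rewrite big_seq1.
by move=> y; rewrite inE => /eqP ->.
Qed.

Lemma finite_sumsD x y :
  finite_sums E x -> finite_sums E y -> finite_sums E (x + y).
Proof.
move=> [s hs ->] [r hr ->]; exists (s ++ r); last by rewrite big_cat.
by move=> z; rewrite mem_cat => /orP[/hs|/hr].
Qed.

Lemma finite_sums_ind (P : V -> Prop) :
  P 0 -> (forall x y, P x -> P y -> P (x + y)) -> (forall x, E x -> P x) ->
  forall x, finite_sums E x -> P x.
Proof.
move=> P0 PD PE _ [s hs ->]; rewrite big_seq.
by apply: big_ind => // y /hs /PE.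
Qed.

End FiniteSums.

(** Unlike [idealr], this allows the whole ring and asks for no boolean predicate, so products and
    images of ideals can be treated directly as sets. Closure under opposites follows by multiplying
    by -1. *)
Definition is_ideal (R : nzRingType) (J : set R) :=
  [/\ J 0, forall x y, J x -> J y -> J (x + y) & forall a x, J x -> J (a * x)].

Section Ideals.

Variables (R : nzRingType) (J : set R).
Hypothesis J_ideal : is_ideal J.

Lemma is_ideal0 : J 0. Proof. by case: J_ideal. Qed.

Lemma is_idealD x y : J x -> J y -> J (x + y).
Proof. by case: J_ideal => _ + _; apply. Qed.

Lemma is_idealM a x : J x -> J (a * x).
Proof. by case: J_ideal => _ _; apply. Qed.

Lemma is_ideal_sum (T : Type) (s : seq T) (P : pred T) (F : T -> R) :
  (forall i, P i -> J (F i)) -> J (\sum_(i <- s | P i) F i).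
Proof.
by move=> hF; apply: big_ind => //; [apply: is_ideal0|apply: is_idealD].
Qed.

End Ideals.

Lemma idealr_is_ideal (R : nzRingType) (J : idealr R) : is_ideal [set` J].
Proof.
split; first exact: (rpred0 J).
  by move=> x y; exact: rpredD.
by move=> a x; apply: idealMr.
Qed.

(** Classical reflection turns [S] into a boolean predicate, and [~ S 1] supplies the properness
    that [idealr] demands. *)
Lemma idealr_of_set (R : nzRingType) (S : set R) :
  is_ideal S -> ~ S 1 -> exists J : idealr R, [set` J] = S.
Proof.
move=> iS S1; pose P (x : R) := `[< S x >].
have cP : idealr_closed (P : {pred R}).
  split; first by apply/asboolP; apply: is_ideal0.
    by apply/negP => /asboolP.
  move=> a x y /asboolP Sx /asboolP Sy; apply/asboolP.
  by apply: is_idealD => //; apply: is_idealM.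
pose J : idealr R := HB.pack (P : R -> bool) (isIdealr.Build R P cP).
exists J; apply/seteqP; split => x; first by move=> /asboolP.
by move=> Sx; apply/asboolP.
Qed.

(** * Free and spanning families modulo an ideal *)

Section QuotientDimension.

Variables (k : fieldType) (A : stdGradedAlg k) (W : set A).
Hypothesis W_ideal : is_ideal W.

Definition spans_mod (U : set A) d (b : 'I_d -> A) :=
  forall x, U x -> exists c : 'I_d -> k, W (x - \sum_i sg_emb A (c i) * b i).

Definition free_mod d (b : 'I_d -> A) :=
  forall c : 'I_d -> k, W (\sum_i sg_emb A (c i) * b i) -> forall i, c i = 0.

(** Steinitz bound: the coordinates of [b] in terms of [g] form an e by d matrix. If d < e, a
    nonzero vector of its left kernel is a forbidden relation among the [b i] modulo [W]. *)
Lemma free_mod_leq_spans (U : set A) d e (g : 'I_d -> A) (b : 'I_e -> A) :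
  spans_mod U g -> (forall i, U (b i)) -> free_mod b -> (e <= d)%N.
Proof.
move=> gU bU b_free.
have /boolp.choice [M hM] i := gU _ (bU i).
pose N : 'M[k]_(e, d) := \matrix_(i, j) M i j.
rewrite leqNgt; apply/negP => de.
have : kermx N != 0.
  rewrite kermx_eq0 /row_free neq_ltn.
  by rewrite (leq_ltn_trans (rank_leq_col N) de).
move=> /rowV0Pn [v /sub_kermxP vN v0].
case/negP: v0; apply/eqP/rowP => i; rewrite mxE.
apply: (b_free (fun i => v 0 i)).
(* Since v N = 0, the combinations of [g] cancel, so each [b i0] may be replaced by its remainder,
   which lies in [W]. *)
have -> : \sum_i0 sg_emb A (v 0 i0) * b i0 =
  \sum_i0 sg_emb A (v 0 i0) * (b i0 - \sum_j sg_emb A (M i0 j) * g j).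
  under [RHS]eq_bigr do rewrite mulrBr mulr_sumr.
  rewrite sumrB exchange_big /= -[LHS]subr0; congr (_ - _).
  symmetry; apply: big1 => j _.
  have /(congr1 (fun w : 'rV__ => sg_emb A (w 0 j))) := vN.
  rewrite !mxE rmorph_sum rmorph0 => h0.
  transitivity ((\sum_i sg_emb A (v 0 i * N i j)) * g j).
    rewrite mulr_suml; apply: eq_bigr => l _.
    by rewrite mxE rmorphM mulrA.
  by rewrite h0 mul0r.
by apply: is_ideal_sum => // l _; apply: is_idealM.
Qed.

(** A free family of maximal length in [U] is a basis. Lengths are bounded through [U'], so the
    spanning family [g] need not lie in [U]. *)
Lemma has_quot_dim_exists (U U' : set A) d (g : 'I_d -> A) :
  U `<=` U' -> spans_mod U' g -> exists e, has_quot_dim U W e.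
Proof.
move=> UU' gU'.
pose P e := `[< exists b : 'I_e -> A, (forall i, U (b i)) /\ free_mod b >].
have P0 : exists e, P e.
  by exists 0%N; apply/asboolP; exists (fun _ => 0); split => [[]|c _ []].
have Pd e : P e -> (e <= d)%N.
  move=> /asboolP [b [bU]]; apply: (free_mod_leq_spans gU') => i.
  exact/UU'/bU.
case: (ex_maxnP P0 Pd) => e /asboolP [b [bU b_free]] e_max.
exists e, b; split => // x Ux.
(* [x] is put in front of [b]. By maximality the longer family has a nontrivial relation; freeness
   of [b] makes the coefficient of [x] nonzero, and the relation is solved for [x]. *)
pose b' i := oapp b x (unlift ord0 i).
have [c hc [i ci]] : exists2 c : 'I_e.+1 -> k,
    W (\sum_i sg_emb A (c i) * b' i) & exists i, c i <> 0.
  apply: contrapT => nofree; suff /e_max : P e.+1 by rewrite ltnn.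
  apply/asboolP; exists b'; split => [i|c hc i].
    by rewrite /b'; case: unlift.
  by apply: contrapT => ci; apply: nofree; exists c => //; exists i.
move: hc; rewrite big_ord_recl /b' unlift_none /=.
under eq_bigr do rewrite liftK /=.
move=> hc.
have c0 : c ord0 != 0.
  apply/eqP => c0; apply: ci; move: hc; rewrite c0 rmorph0 mul0r add0r.
  by move=> /b_free cl; case: (unliftP ord0 i) => [j|] ->.
exists (fun i => - (c ord0)^-1 * c (lift ord0 i)).
rewrite -sumrN.
have -> : x + \sum_i0 - (sg_emb A (- (c ord0)^-1 * c (lift ord0 i0)) * b i0)
   = sg_emb A (c ord0)^-1 * (sg_emb A (c ord0) * x +
      \sum_(i0 < e) sg_emb A (c (lift ord0 i0)) * b i0).
  rewrite mulrDr mulrA -rmorphM mulVf // rmorph1 mul1r; congr (_ + _).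
  rewrite mulr_sumr; apply: eq_bigr => j _.
  by rewrite mulNr rmorphN mulNr opprK rmorphM mulrA.
exact: is_idealM.
Qed.

End QuotientDimension.

Lemma mnm_neq0_split n (u : 'X_{1..n}) :
  u != 0%MM -> exists i v, u = (U_(i) + v)%MM.
Proof.
move=> u0; have [i ui] : exists i, u i != 0%N.
  apply/existsP; rewrite -negb_forall; apply: contra u0 => /forallP h.
  by apply/eqP/mnmP => i; rewrite mnm0E; apply/eqP.
by exists i, (u - U_(i))%MM; rewrite addmC submK // lep1mP.
Qed.

(** * The irrelevant ideal, admissible ideals, and the basic properties of [mu] and [ms] *)

Section Irrelevant.

Variables (k : fieldType) (A : stdGradedAlg k).

Local Notation mA := (@irrelevant_ideal k A).

Lemma sg_grD d (x y : A) : sg_gr d x -> sg_gr d y -> sg_gr d (x + y).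
Proof.
move=> gx gy;  have [g0 gB] := sg_gr_zmod A d.
by rewrite -[y]opprK; apply: (gB) => //; rewrite -sub0r; apply: gB.
Qed.

Lemma sg_gr_0 d : sg_gr d (0 : A).
Proof. by have [] := sg_gr_zmod A d. Qed.

Lemma sg_grS_irrelevant d (x : A) : sg_gr d.+1 x -> mA x.
Proof. by move=> gx; apply: finite_sums_incl; exists d. Qed.

Lemma sg_gr_irrelevant d (x : A) : (0 < d)%N -> sg_gr d x -> mA x.
Proof. by case: d => // d _; apply: sg_grS_irrelevant. Qed.

Lemma irrelevant_is_ideal : is_ideal mA.
Proof.
split; [exact: finite_sums0|exact: finite_sumsD|move=> a x].
move: a (sg_span a) x; apply: finite_sums_ind.
- by move=> x _; rewrite mul0r; apply: finite_sums0.
- move=> a b ha hb x mx; rewrite mulrDl.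
  by apply: finite_sumsD; [apply: ha|apply: hb].
move=> a [d ga]; apply: finite_sums_ind.
- by rewrite mulr0; apply: finite_sums0.
- by move=> x y hx hy; rewrite mulrDr; apply: finite_sumsD.
move=> x [e gx]; apply: (@sg_grS_irrelevant (d + e)).
by rewrite -addnS; apply: sg_grM.
Qed.

(** Grouping the summands of [x] by degree brings it into the form to which [sg_direct] applies; the
    index is shifted, [f d] having degree d + 1. *)
Lemma irrelevant_components (x : A) : mA x -> exists n (f : nat -> A),
  [/\ forall d, sg_gr d.+1 (f d), forall d, (n <= d)%N -> f d = 0
    & x = \sum_(d < n) f d].
Proof.
move: x; apply: finite_sums_ind.
- exists 0%N, (fun=> 0); split=> //; last by rewrite big_ord0.
  by move=> d; apply: sg_gr_0.
- move=> x y [n [f [fg fn ->]]] [n' [f' [fg' fn' ->]]].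
  have widen l (h : nat -> A) : (l <= n + n')%N ->
      (forall d, (l <= d)%N -> h d = 0) ->
      \sum_(d < l) h d = \sum_(d < n + n') h d.
    move=> le_l hl; rewrite -!(big_mkord xpredT h).
    rewrite (big_cat_nat (n := l) _ le_l) //= [X in _ + X]big_nat_cond.
    by rewrite [X in _ + X]big1 ?addr0 // => i /andP[/andP[/hl]].
  exists (n + n')%N, (fun d => f d + f' d); split.
  + by move=> d; apply: sg_grD.
  + move=> d le_d; rewrite fn ?fn' ?addr0 //.
      exact: leq_trans (leq_addl _ _) le_d.
    exact: leq_trans (leq_addr _ _) le_d.
  + by rewrite big_split (widen n f) ?(widen n' f') ?leq_addr ?leq_addl.
move=> x [d gx]; exists d.+1, (fun e => if e == d then x else 0); split.
- by move=> e; case: eqP => [->|_] //; apply: sg_gr_0.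
- by move=> e; case: eqP => // ->; rewrite ltnn.
rewrite big_ord_recr /= eqxx big1 ?add0r // => i _.
by rewrite (ltn_eqF (ltn_ord i)).
Qed.

Lemma irrelevant1 : ~ mA 1.
Proof.
move=> /irrelevant_components [n [f [fg _ e1]]].
(* With -1 placed in degree 0 the components of 1 sum to zero, so directness would force -1 = 0. *)
pose h d := if d is e.+1 then f e else - 1.
have /= h0 : h 0%N = 0.
  apply: (@sg_direct _ A n.+1 h) => //.
    move=> [|d] //=; rewrite sg_gr0; exists (- 1) => //.
    by rewrite rmorphN rmorph1.
  by rewrite big_ord_recl /= -e1 addNr.
by move/eqP: h0; rewrite oppr_eq0 oner_eq0.
Qed.

(** Together with [irrelevant_emb] this identifies A/m with k, so coefficients can be reduced to
    scalars modulo m. *)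
Lemma irrelevant_complement (x : A) : exists c, mA (x - sg_emb A c).
Proof.
have mI := irrelevant_is_ideal.
move: x (sg_span x); apply: finite_sums_ind.
- by exists 0; rewrite rmorph0 subr0; apply: is_ideal0.
- move=> x y [c hc] [c' hc']; exists (c + c').
  by rewrite rmorphD opprD addrACA; apply: is_idealD.
move=> x [[|d] gx].
  move: gx; rewrite sg_gr0 => -[c _ <-]; exists c; rewrite subrr.
  exact: is_ideal0.
by exists 0; rewrite rmorph0 subr0; apply: sg_grS_irrelevant gx.
Qed.

Lemma irrelevant_emb c : mA (sg_emb A c) -> c = 0.
Proof.
move=> hc; apply/eqP/negP => /negP c0; apply: irrelevant1.
rewrite -(rmorph1 (sg_emb A)) -(mulVf c0) rmorphM.
by apply: is_idealM => //; apply: irrelevant_is_ideal.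
Qed.

Lemma ideal_prodM (J K : set A) x y : J x -> K y -> ideal_prod J K (x * y).
Proof. by move=> Jx Ky; apply: finite_sums_incl; exists x, y. Qed.

Lemma ideal_prod_ind (J K : set A) (P : A -> Prop) :
  P 0 -> (forall x y, P x -> P y -> P (x + y)) ->
  (forall x y, J x -> K y -> P (x * y)) ->
  forall z, ideal_prod J K z -> P z.
Proof.
move=> P0 PD PM; apply: finite_sums_ind => //.
by move=> _ [x [y [Jx Ky ->]]]; apply: PM.
Qed.

Lemma ideal_prod_is_ideal (J K : set A) :
  is_ideal J -> is_ideal (ideal_prod J K).
Proof.
move=> JI; split; [exact: finite_sums0|exact: finite_sumsD|move=> a].
apply: ideal_prod_ind.
- by rewrite mulr0; apply: finite_sums0.
- by move=> x y; rewrite mulrDr; apply: finite_sumsD.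
by move=> x y Jx Ky; rewrite mulrA; apply: ideal_prodM => //; apply: is_idealM.
Qed.

(** Set-level form of [ms_admissible], which images and extensions can satisfy without being packed
    as an [idealr]; [admissible_setP] relates the two. *)
Definition admissible_set (J : set A) :=
  [/\ is_ideal J, homogeneous_ideal (@sg_gr k A) J, J `<=` mA
    & ideal_prod mA mA `<=` J].

Lemma admissible_irrelevant : admissible_set mA.
Proof.
split => //; first exact: irrelevant_is_ideal.
  apply: finite_sums_ind; [exact: finite_sums0|exact: finite_sumsD|].
  move=> x [d gx]; apply: finite_sums_incl; split; last by exists d.+1.
  exact: sg_grS_irrelevant gx.
apply: ideal_prod_ind.
- exact: is_ideal0 irrelevant_is_ideal.
- exact: is_idealD irrelevant_is_ideal.
by move=> x y _; apply: is_idealM irrelevant_is_ideal _ _.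
Qed.

Lemma mmap1_irrelevant r (g : 'I_r -> A) (u : 'X_{1..r}) :
  (forall i, sg_gr 1 (g i)) -> (0 < mdeg u)%N ->
  exists i v, [/\ mA (g i), mdeg u = (mdeg v).+1 & mmap1 g u = g i * mmap1 g v].
Proof.
move=> g1; rewrite lt0n mdeg_eq0 => /mnm_neq0_split [i [v ->]].
exists i, v; split; first exact: sg_grS_irrelevant (g1 i).
  by rewrite mdegD mdeg1.
by rewrite commr_mmap1_M ?mmap1U // => j x; rewrite /GRing.comm mulrC.
Qed.

(* The monomials of degree at most 2 in generators of degree one span A modulo
   m^3, which is contained in mJ. *)
Lemma admissible_finite (J : set A) : admissible_set J ->
  exists d (g : 'I_d -> A), spans_mod (ideal_prod mA J) setT g.
Proof.
move=> [JI _ _ m2J]; have mI := irrelevant_is_ideal.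
have mJI := ideal_prod_is_ideal J mI.
have [r [g [g1 gen]]] := sg_gen A.
exists #|{: 'X_{1..r < 3}}|, (fun i => mmap1 g (enum_val i : 'X_{1..r < 3})).
move=> x _; have [p ->] := gen x.
exists (fun i => p@_(enum_val i : 'X_{1..r < 3})).
(* [q] is the truncation of [p] to degrees below 3; only the monomials of [p - q] remain to be
   treated. *)
pose q := \sum_(u : 'X_{1..r < 3}) p@_u *: 'X_[u].
have -> : mmap (sg_emb A) g p -
    \sum_(i < #|{: 'X_{1..r < 3}}|)
      sg_emb A p@_(enum_val i : 'X_{1..r < 3}) * mmap1 g (enum_val i : 'X_{1..r < 3})
    = mmap (sg_emb A) g (p - q).
  rewrite raddfB /=; congr (_ - _); rewrite raddf_sum /=.
  rewrite -(big_enum_val (fun u : 'X_{1..r < 3} =>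
    sg_emb A p@_u * mmap1 g u)) /=.
  by apply: eq_bigr => u _; rewrite mmapZ mmapX.
rewrite /mmap big_seq; apply: is_ideal_sum => // u; rewrite mcoeff_msupp => pu.
apply: is_idealM => //.
have u3 : (2 < mdeg u)%N.
  rewrite ltnNge; apply: contra pu => u2.
  by rewrite mcoeffB /q (mcoeff_mpoly (fun v => p@_v)) // subrr.
(* Three generators are split off: the first is the factor in m, while the second times the rest,
   which still contains the third, lies in m^2 and hence in J. *)
have [i [v [gi uv ->]]] := mmap1_irrelevant g1 (ltnW (ltnW u3)).
rewrite uv ltnS in u3.
have [j [w [gj vw ->]]] := mmap1_irrelevant g1 (ltnW u3).
rewrite vw ltnS in u3.
have [l [z [gl _ ->]]] := mmap1_irrelevant g1 u3.
apply: ideal_prodM => //; apply/m2J/ideal_prodM => //.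
by rewrite mulrC; apply: is_idealM.
Qed.

(** Finiteness of A modulo mJ ensures that a dimension exists, so [mu J] is a genuine dimension and
    not the default of [xget]. *)
Lemma has_quot_dim_mu (J : set A) : admissible_set J ->
  has_quot_dim J (ideal_prod mA J) (mu J).
Proof.
move=> adJ; have [d [g gT]] := admissible_finite adJ.
apply: xgetPex; apply: (has_quot_dim_exists _ _ gT) => //.
exact/ideal_prod_is_ideal/irrelevant_is_ideal.
Qed.

Lemma mu_leq (J : set A) d (g : 'I_d -> A) : admissible_set J ->
  spans_mod (ideal_prod mA J) J g -> (mu J <= d)%N.
Proof.
move=> adJ gJ; have [b [bJ _ b_free]] := has_quot_dim_mu adJ.
apply: (free_mod_leq_spans _ gJ bJ b_free).
exact/ideal_prod_is_ideal/irrelevant_is_ideal.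
Qed.

Lemma leq_mu (J : set A) d (b : 'I_d -> A) : admissible_set J ->
  (forall i, J (b i)) -> free_mod (ideal_prod mA J) b -> (d <= mu J)%N.
Proof.
move=> adJ bJ b_free; have [g [_ gJ _]] := has_quot_dim_mu adJ.
apply: (free_mod_leq_spans _ gJ bJ b_free).
exact/ideal_prod_is_ideal/irrelevant_is_ideal.
Qed.

Lemma admissible_setP (J : set A) :
  admissible_set J <-> exists2 I : idealr A, ms_admissible I & [set` I] = J.
Proof.
split=> [[JI Jhom JmA m2J]|[I [Ihom ImA m2I] <-]]; last first.
  by split=> //; apply: idealr_is_ideal.
have [I IJ] := idealr_of_set JI (fun J1 => irrelevant1 (JmA _ J1)).
by exists I => //; rewrite /ms_admissible IJ.
Qed.

(** The values of [mu] on admissible ideals form a set of naturals that is nonempty because of m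
    itself, so it has a least element and [xget] does not return its default. *)
Lemma ms_spec : (exists2 J, admissible_set J & mu J = ms A) /\
  (forall J, admissible_set J -> (ms A <= mu J)%N).
Proof.
pose P d := `[< exists2 J, admissible_set J & mu J = d >].
have : exists d, P d.
  by exists (mu mA); apply/asboolP; exists mA => //; apply: admissible_irrelevant.
move=> /ex_minnP [d /asboolP [J adJ Jd] d_min].
have : exists d, [set d | (exists2 I : idealr A, ms_admissible I & mu [set` I] = d) /\
    (forall I : idealr A, ms_admissible I -> (d <= mu [set` I])%N)] d.
  exists d; split.
    by have /admissible_setP [I adI IJ] := adJ; exists I; rewrite ?IJ.
  move=> I adI; apply: d_min; apply/asboolP; exists [set` I] => //.
  by apply/admissible_setP; exists I.
move=> /(xgetPex 0%N); rewrite -/(ms A) => -[[I adI muI] ms_min]; split.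
  by exists [set` I] => //; apply/admissible_setP; exists I.
by move=> K /admissible_setP [L adL <-]; apply: ms_min.
Qed.

End Irrelevant.

(** * Concatenation of finite families *)

Lemma split_ord_ind d e (P : 'I_(d + e) -> Prop) :
  (forall i, P (lshift e i)) -> (forall i, P (rshift d i)) -> forall i, P i.
Proof.
by move=> Pl Pr i; rewrite -[i]splitK; case: (fintype.split i).
Qed.

Section ConcatFamilies.

Variables (T : Type) (d e : nat) (f : 'I_d -> T) (g : 'I_e -> T).

Definition cat_family (i : 'I_(d + e)) : T :=
  match fintype.split i with inl j => f j | inr j => g j end.

Lemma cat_familyl i : cat_family (lshift e i) = f i.
Proof. by rewrite /cat_family -[lshift e i]/(unsplit (inl i)) unsplitK. Qed.

Lemma cat_familyr i : cat_family (rshift d i) = g i.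
Proof. by rewrite /cat_family -[rshift d i]/(unsplit (inr i)) unsplitK. Qed.

End ConcatFamilies.

(** * Lower bounds for [mu] along a graded surjection *)

Section Descent.

Variables (k : fieldType) (A B : stdGradedAlg k) (phi : {rmorphism B -> A}).

Hypothesis phi_emb : forall c, phi (sg_emb B c) = sg_emb A c.
Hypothesis phi_gr : forall d y, sg_gr d y -> sg_gr d (phi y).
Hypothesis phi_lift :
  forall d x, sg_gr d x -> exists2 y, sg_gr d y & phi y = x.

Local Notation mA := (@irrelevant_ideal k A).
Local Notation mB := (@irrelevant_ideal k B).

Lemma graded_morph_irrelevant y : mB y -> mA (phi y).
Proof.
move: y; apply: finite_sums_ind.
- by rewrite rmorph0; apply: finite_sums0.
- by move=> x y hx hy; rewrite rmorphD; apply: finite_sumsD.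
by move=> x [d /phi_gr gx]; apply: sg_grS_irrelevant gx.
Qed.

Lemma irrelevant_lift x : mA x -> exists2 y, mB y & phi y = x.
Proof.
move: x; apply: finite_sums_ind.
- by exists 0; [apply: finite_sums0|apply: rmorph0].
- move=> _ _ [x mx <-] [y my <-]; exists (x + y); last exact: rmorphD.
  exact: finite_sumsD.
by move=> _ [d /phi_lift [y gy <-]]; exists y => //; apply: sg_grS_irrelevant gy.
Qed.

Lemma graded_morph_surj x : exists y, phi y = x.
Proof.
move: x (sg_span x); apply: finite_sums_ind.
- by exists 0; apply: rmorph0.
- by move=> _ _ [x <-] [y <-]; exists (x + y); apply: rmorphD.
by move=> _ [d /phi_lift [y _ <-]]; exists y.
Qed.

(** Surjectivity makes the image an ideal; lifting degree by degree sends products from m_A back to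
    products from m_B, so the image contains m_A^2. *)
Lemma admissible_image J : admissible_set J -> admissible_set (phi @` J).
Proof.
move=> [JI Jhom JmB m2J]; split.
- split; first by exists 0; [apply: is_ideal0|apply: rmorph0].
    move=> _ _ [x Jx <-] [y Jy <-].
    by exists (x + y); [apply: is_idealD|apply: rmorphD].
  move=> a _ [x Jx <-]; have [b <-] := graded_morph_surj a.
  by exists (b * x); [apply: is_idealM|apply: rmorphM].
- move=> _ [x /Jhom hx <-]; move: x hx; apply: finite_sums_ind.
  + by rewrite rmorph0; apply: finite_sums0.
  + by move=> x y hx hy; rewrite rmorphD; apply: finite_sumsD.
  move=> x [Jx [d gx]]; apply: finite_sums_incl; split; first by exists x.
  by exists d; apply: phi_gr.
- by move=> _ [x /JmB mx <-]; apply: graded_morph_irrelevant.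
apply: ideal_prod_ind.
- by exists 0; [apply: is_ideal0|apply: rmorph0].
- move=> _ _ [x Jx <-] [y Jy <-].
  by exists (x + y); [apply: is_idealD|apply: rmorphD].
move=> x y /irrelevant_lift [x' mx <-] /irrelevant_lift [y' my <-].
by exists (x' * y'); [apply/m2J/ideal_prodM|apply: rmorphM].
Qed.

(** A basis of the image of J modulo m_A times that image is lifted to J and joined with [f]. In a
    relation modulo m_B J, applying [phi] kills the [f] part and forces the coefficients of the
    lifts to vanish; freeness of [f] then disposes of the others. *)
Lemma ms_leq_descent (J : set B) s (f : 'I_s -> B) :
  admissible_set J -> (forall i, J (f i)) -> (forall i, phi (f i) = 0) ->
  free_mod (ideal_prod mB J) f -> (ms A + s <= mu J)%N.
Proof.
move=> adJ fJ phif f_free; have adI := admissible_image adJ.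
apply: (leq_trans (n := mu (phi @` J) + s)).
  by rewrite leq_add2r; have [_] := ms_spec A; apply.
have [b [bI _ b_free]] := has_quot_dim_mu adI.
have /boolp.choice [e he] i : exists y, J y /\ phi y = b i.
  by have [y] := bI i; exists y.
apply: (leq_mu (b := cat_family e f) adJ).
  apply: split_ord_ind => i; rewrite ?cat_familyl ?cat_familyr //.
  by case: (he i).
move=> c; rewrite big_split_ord /=.
under eq_bigr do rewrite cat_familyl.
under [X in _ + X]eq_bigr do rewrite cat_familyr.
move=> hc.
have hphi z : ideal_prod mB J z -> ideal_prod mA (phi @` J) (phi z).
  move: z; apply: ideal_prod_ind.
  - by rewrite rmorph0; apply: finite_sums0.
  - by move=> x y hx hy; rewrite rmorphD; apply: finite_sumsD.
  move=> x y mx Jy; rewrite rmorphM; apply: ideal_prodM.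
    exact: graded_morph_irrelevant.
  by exists y.
have cl : forall i, c (lshift s i) = 0.
  apply: b_free; have := hphi _ hc; rewrite rmorphD !rmorph_sum /=.
  rewrite [X in _ + X]big1 ?addr0; last by move=> i _; rewrite rmorphM phif mulr0.
  by under eq_bigr do rewrite rmorphM phi_emb (he _).2.
apply: split_ord_ind => //.
apply: f_free; move: hc; rewrite big1 ?add0r // => i _.
by rewrite cl rmorph0 mul0r.
Qed.

End Descent.

(** * The irrelevant ideal of a polynomial extension *)

Section PolyIrrelevant.

Variables (k : fieldType) (A : stdGradedAlg k) (m : nat).

Local Notation B := (polySGA A m).
Local Notation mA := (@irrelevant_ideal k A).
Local Notation mB := (@irrelevant_ideal k B).

Lemma poly_grX (u : 'X_{1..m}) : @sg_gr k B (mdeg u) 'X_[u].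
Proof.
move=> v; rewrite mcoeffX; case: (eqVneq u v) => [<-|_].
  by rewrite leqnn subnn sg_gr0; exists 1 => //; apply: rmorph1.
by case: ifP => // _; apply: sg_gr_0.
Qed.

Lemma poly_grC d (a : A) : sg_gr d a -> @sg_gr k B d a%:MP.
Proof.
move=> ga v; rewrite mcoeffC; case: (eqVneq v 0%MM) => [->|_].
  by rewrite mdeg0 subn0 mulr1.
by rewrite mulr0; case: ifP => // _; apply: sg_gr_0.
Qed.

Lemma poly_grCX d (a : A) (u : 'X_{1..m}) :
  sg_gr d a -> @sg_gr k B (d + mdeg u) (a *: 'X_[u]).
Proof.
move=> ga; rewrite -mul_mpolyC.
exact: (@sg_grM k B _ _ _ _ (poly_grC ga) (poly_grX u)).
Qed.

Lemma polyC_irrelevant (a : A) : mA a -> mB a%:MP.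
Proof.
move: a; apply: finite_sums_ind.
- by rewrite mpolyC0; apply: finite_sums0.
- by move=> x y hx hy; rewrite mpolyCD; apply: finite_sumsD.
by move=> x [d gx]; apply: sg_grS_irrelevant (poly_grC gx).
Qed.

(** This is m_B = m_A B + (X_1, ..., X_m): every monomial other than 1 has positive degree, so only
    the constant coefficient is constrained. *)
Lemma poly_irrelevantE (p : {mpoly A[m]}) : mB p <-> mA p@_0%MM.
Proof.
have mI := irrelevant_is_ideal A; have mBI := irrelevant_is_ideal B.
split.
  move: p; apply: finite_sums_ind.
  - by rewrite mcoeff0; apply: is_ideal0.
  - by move=> x y hx hy; rewrite mcoeffD; apply: is_idealD.
  move=> x [d gx]; have := gx 0%MM; rewrite mdeg0 subn0 /=.
  exact: sg_grS_irrelevant.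
move=> p0; rewrite [p]mpolyE; apply: is_ideal_sum => // u _.
case: (eqVneq u 0%MM) => [->|u0].
  by rewrite mpolyX0 alg_mpolyC; apply: polyC_irrelevant.
rewrite -mul_mpolyC; apply: is_idealM => //.
by apply: (sg_gr_irrelevant _ (poly_grX u)); rewrite lt0n mdeg_eq0.
Qed.

Lemma mcoeffM_irrelevant (p q : {mpoly A[m]}) (u : 'X_{1..m}) :
  (forall v w, u = (v + w)%MM -> mA p@_v \/ mA q@_w) -> mA (p * q)@_u.
Proof.
move=> h; have mI := irrelevant_is_ideal A; rewrite mcoeffM.
apply: is_ideal_sum => // -[v w] /= /eqP /h [hv|hw].
  by rewrite mulrC; apply: is_idealM.
exact: is_idealM.
Qed.

End PolyIrrelevant.

(** * Extending an admissible ideal by the new variables *)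

Section PolyUpperBound.

Variables (k : fieldType) (A : stdGradedAlg k) (m : nat).

Local Notation B := (polySGA A m).
Local Notation mA := (@irrelevant_ideal k A).
Local Notation mB := (@irrelevant_ideal k B).

Variable J : set A.
Hypothesis adJ : admissible_set J.

(** This is the ideal JB + (X_1, ..., X_m). *)
Definition poly_ext_ideal : set B := [set p : {mpoly A[m]} | J p@_0%MM].

Lemma admissible_poly_ext : admissible_set poly_ext_ideal.
Proof.
have [JI Jhom JmA m2J] := adJ; split.
- split; first by rewrite /poly_ext_ideal /= mcoeff0; apply: is_ideal0.
    by move=> p q; rewrite /poly_ext_ideal /= mcoeffD; apply: is_idealD.
  by move=> p q; rewrite /poly_ext_ideal /= rmorphM; apply: is_idealM.
- move=> p Jp; rewrite [p]mpolyE big_seq.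
  apply: big_ind => [||u _]; [exact: finite_sums0|exact: finite_sumsD|].
  (* The constant coefficient must be decomposed inside [J], whereas any other coefficient may be
     decomposed in all of [A], because its monomial already lies in the extension. The premise under
     [u = 0%MM] covers both cases at once. *)
  have hom (y : A) : homogeneous (@sg_gr k A) y -> (u = 0%MM -> J y) ->
      (poly_ext_ideal `&` homogeneous (@sg_gr k B)) (y *: 'X_[u]).
    move=> [d gy] Jy; split; last by exists (d + mdeg u)%N; apply: poly_grCX.
    rewrite /poly_ext_ideal /= mcoeffZ mcoeffX.
    by case: eqVneq => [/Jy|_]; rewrite ?mulr1 ?mulr0 //; apply: is_ideal0.
  have ext (y : A) (E : set A) : (forall z, E z -> homogeneous (@sg_gr k A) z) ->
      (forall z, E z -> u = 0%MM -> J z) -> finite_sums E y ->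
      finite_sums (poly_ext_ideal `&` homogeneous (@sg_gr k B)) (y *: 'X_[u]).
    move=> Eh EJ; move: y; apply: finite_sums_ind.
    + by rewrite scale0r; apply: finite_sums0.
    + by move=> x y hx hy; rewrite scalerDl; apply: finite_sumsD.
    by move=> y Ey; apply/finite_sums_incl/hom; auto.
  case: (eqVneq u 0%MM) => [u0|u0].
    by apply: ext (Jhom _ _) => [z []|z []|] //; rewrite u0.
  by apply: ext (sg_span _) => // z _ /eqP; rewrite (negbTE u0).
- by move=> p /JmA /poly_irrelevantE.
apply: ideal_prod_ind.
- by rewrite /poly_ext_ideal /= mcoeff0; apply: is_ideal0.
- by move=> p q; rewrite /poly_ext_ideal /= mcoeffD; apply: is_idealD.
move=> p q /poly_irrelevantE mp /poly_irrelevantE mq.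
by rewrite /poly_ext_ideal /= rmorphM; apply/m2J/ideal_prodM.
Qed.

(** Terms of degree at least two in the variables are automatically in the product, since a variable
    can be split off into m_B and the rest is still in the extension. Only the constant and linear
    coefficients need conditions. *)
Lemma poly_ext_prod (p : {mpoly A[m]}) :
  ideal_prod mA J p@_0%MM -> (forall i, mA p@_U_(i)) ->
  ideal_prod mB poly_ext_ideal p.
Proof.
have [JI _ _ _] := adJ; move=> p0 p1.
have WI : is_ideal (ideal_prod mB poly_ext_ideal).
  exact/ideal_prod_is_ideal/irrelevant_is_ideal.
rewrite [p]mpolyE; apply: is_ideal_sum => // u _.
case: (eqVneq u 0%MM) => [->|u0].
  rewrite mpolyX0 alg_mpolyC; move: p@_0%MM p0; apply: ideal_prod_ind.
  - by rewrite mpolyC0; apply: is_ideal0.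
  - by move=> x y hx hy; rewrite mpolyCD; apply: is_idealD.
  move=> x y mx Jy; rewrite mpolyCM; apply: ideal_prodM.
    exact: polyC_irrelevant.
  by rewrite /poly_ext_ideal /= mcoeffC eqxx mulr1.
have extX (v : 'X_{1..m}) : v != 0%MM -> poly_ext_ideal 'X_[v].
  move=> v0; rewrite /poly_ext_ideal /= mcoeffX (negbTE v0).
  exact: is_ideal0.
have irrX (v : 'X_{1..m}) : v != 0%MM -> mB 'X_[v].
  move=> v0; apply/poly_irrelevantE; rewrite mcoeffX (negbTE v0).
  exact: is_ideal0 (irrelevant_is_ideal A).
have [i [v ->]] := mnm_neq0_split u0.
case: (eqVneq v 0%MM) => [->|v0].
  rewrite addm0 -mul_mpolyC; apply: ideal_prodM.
    exact/polyC_irrelevant/p1.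
  by apply: extX; rewrite mnm1_eq0.
rewrite mpolyXD -mul_mpolyC; apply: is_idealM => //.
by apply: ideal_prodM; [apply: irrX; rewrite mnm1_eq0|apply: extX].
Qed.

(** A basis of J modulo mJ together with the [m] variables spans the extension. *)
Lemma mu_poly_ext : (mu poly_ext_ideal <= mu J + m)%N.
Proof.
have mI := irrelevant_is_ideal A.
have [b [bJ b_spans _]] := has_quot_dim_mu adJ.
pose b' : 'I_(mu J) -> {mpoly A[m]} := fun i => (b i)%:MP.
pose X' : 'I_m -> {mpoly A[m]} := fun j => 'X_j.
apply: (mu_leq (g := cat_family b' X' : _ -> B) admissible_poly_ext) => p Jp.
have [c hc] := b_spans _ Jp.
(* The scalar attached to X_j is the residue modulo m of the linear coefficient, and [poly_ext_prod]
   absorbs the difference. *)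
have /boolp.choice [e he] j := irrelevant_complement (p@_U_(j) : A).
exists (cat_family c e).
rewrite big_split_ord /=.
under eq_bigr do rewrite !cat_familyl.
under [X in _ - (_ + X)]eq_bigr do rewrite !cat_familyr.
have coefl u : (\sum_(i < mu J) (sg_emb A (c i))%:MP * b' i)@_u
    = (\sum_i sg_emb A (c i) * b i) * (u == 0%MM)%:R.
  rewrite raddf_sum mulr_suml; apply: eq_bigr => i _ /=.
  by rewrite mcoeffCM mcoeffC mulrA eq_sym.
have coefr u : (\sum_(j < m) (sg_emb A (e j))%:MP * X' j)@_u
    = \sum_j sg_emb A (e j) * (U_(j)%MM == u)%:R.
  by rewrite raddf_sum; apply: eq_bigr => j _ /=; rewrite mcoeffCM mcoeffX.
apply: poly_ext_prod => [|l]; rewrite mcoeffB mcoeffD coefl coefr.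
  rewrite eqxx mulr1 (big1 (I := 'I_m)) ?addr0 // => j _.
  by rewrite mnm1_eq0 mulr0.
rewrite mnm1_eq0 mulr0 add0r (bigD1 l) //= eqxx mulr1 big1 ?addr0 // => j jl.
by rewrite eq_mnm1 (negbTE jl) mulr0.
Qed.

End PolyUpperBound.

(** * Evaluation maps that preserve the grading *)

Section PolyMorphisms.

Variables (k : fieldType) (A C : stdGradedAlg k) (m : nat).
Variables (f : {rmorphism A -> C}) (h : 'I_m -> C).
Hypothesis f_gr : forall d x, sg_gr d x -> sg_gr d (f x).
Hypothesis h_gr : forall i, sg_gr 1%N (h i).

Lemma mmap1_gr (u : 'X_{1..m}) : sg_gr (mdeg u) (mmap1 h u).
Proof.
rewrite /mmap1 mdegE.
have grX i (d : nat) : sg_gr d (h i ^+ d).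
  elim: d => [|d IH]; last by rewrite exprS -add1n; apply: sg_grM.
  by rewrite expr0 sg_gr0; exists 1 => //; apply: rmorph1.
apply: (big_ind2 (fun d x => sg_gr d x)) => [|d x e y gx gy|i _] //.
  by rewrite sg_gr0; exists 1 => //; apply: rmorph1.
exact: sg_grM.
Qed.

Lemma mmap_gr d (p : {mpoly A[m]}) : @sg_gr k (polySGA A m) d p ->
  sg_gr d (mmap f h p).
Proof.
move=> gp; rewrite /mmap; apply: sg_gr_sum => u _.
have := gp u; case: leqP => [ud gu|_ ->]; last first.
  by rewrite rmorph0 mul0r; apply: sg_gr_0.
by rewrite -(subnK ud); apply: sg_grM (mmap1_gr u); apply: f_gr.
Qed.

Lemma mmap_gr1 (p : {mpoly A[m]}) : @sg_gr k (polySGA A m) 1%N p ->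
  mmap f h p = f p@_0%MM + \sum_i f p@_U_(i) * h i.
Proof.
move=> gp.
(* In degree one, [poly_gr] makes the coefficients of all monomials of degree two or more vanish. *)
have {1}-> : p = (p@_0%MM)%:MP + \sum_i p@_U_(i) *: 'X_i.
  apply/mpolyP => u; rewrite mcoeffD mcoeffC raddf_sum /=.
  under eq_bigr do rewrite mcoeffZ mcoeffX.
  case: (eqVneq u 0%MM) => [->|u0].
    by rewrite mulr1 big1 ?addr0 // => i _; rewrite mnm1_eq0 mulr0.
  rewrite mulr0 add0r.
  case: (eqVneq (mdeg u) 1%N) => [/eqP|u1].
    rewrite mdeg_eq1 => /existsP [j /eqP ->].
    rewrite (bigD1 j) //= eqxx mulr1 big1 ?addr0 // => i ij.
    by rewrite eq_mnm1 (negbTE ij) mulr0.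
  rewrite big1 => [|i _]; last first.
    by case: eqP => [iu|]; rewrite ?mulr0 //; case/eqP: u1; rewrite -iu mdeg1.
  have := gp u; rewrite leq_eqVlt (negbTE u1) ltnS leqn0 mdeg_eq0.
  by rewrite (negbTE u0).
rewrite raddfD /= mmapC raddf_sum /=; congr (_ + _).
by apply: eq_bigr => i _; rewrite mmapZ mmapX mmap1U.
Qed.

End PolyMorphisms.

(** * The upper bound, a freeness criterion, and the case of no variables *)

Lemma ms_poly_leq (k : fieldType) (A : stdGradedAlg k) m :
  (ms (polySGA A m) <= ms A + m)%N.
Proof.
have [[J adJ <-] _] := ms_spec A; have [_ ms_min] := ms_spec (polySGA A m).
apply: leq_trans (mu_poly_ext m adJ); apply: ms_min.
exact: admissible_poly_ext.
Qed.

(** The coefficient at [u] reduced modulo m_A is a k-linear functional that kills [W] and takes the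
    value 1 at [p]. *)
Lemma free_mod_mcoeff (k : fieldType) (A : stdGradedAlg k) m
    (W : set (polySGA A m)) (p : {mpoly A[m]}) (u : 'X_{1..m}) :
  (forall q : {mpoly A[m]}, W q -> @irrelevant_ideal k A q@_u) -> p@_u = 1 ->
  free_mod W ((fun=> p) : 'I_1 -> polySGA A m).
Proof.
move=> Wu pu c; rewrite big_ord1 => /Wu; rewrite /= mcoeffCM pu mulr1.
by move=> /irrelevant_emb c0 i; rewrite (ord1 i).
Qed.

(** Polynomials in no variables are isomorphic to [A] but not equal to it, so the bound comes from
    descent along evaluation, with an empty family in the kernel. *)
Lemma ms_poly0_geq (k : fieldType) (A : stdGradedAlg k) :
  (ms A <= ms (polySGA A 0))%N.
Proof.
have [[J adJ <-] _] := ms_spec (polySGA A 0).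
pose h : 'I_0 -> A := fun=> 0.
pose phi : {rmorphism polySGA A 0 -> A} := mmap idfun h.
rewrite -[ms A]addn0.
apply: (@ms_leq_descent _ _ _ phi _ _ _ J 0%N (fun=> 0)) => //.
- by move=> c; rewrite /phi /= mmapC.
- by move=> d y gy; apply: (mmap_gr (f := idfun)) => // -[].
- move=> d x gx; exists x%:MP; first exact: poly_grC.
  by rewrite /phi /= mmapC.
- by case.
- by case.
by move=> c _ [].
Qed.

(** * Eliminating the last variable *)

Section LastVariable.

Variables (k : fieldType) (A : stdGradedAlg k) (m : nat).

Local Notation mA := (@irrelevant_ideal k A).
Local Notation B := (polySGA A m.+1).
Local Notation C := (polySGA A m).
Local Notation mB := (@irrelevant_ideal k B).

(** The sign is chosen so that the substitution kills X + a, where X is the last variable. *)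
Definition last_subst (a : {mpoly A[m]}) (i : 'I_m.+1) : {mpoly A[m]} :=
  oapp (fun j => 'X_j) (- a) (unlift ord_max i).

Definition subst_last (a : {mpoly A[m]}) : {rmorphism B -> C} :=
  mmap (@mpolyC m A) (last_subst a).

Lemma poly_gr1X n (j : 'I_n) : @sg_gr k (polySGA A n) 1%N 'X_j.
Proof. by have := poly_grX A U_(j); rewrite mdeg1. Qed.

Lemma subst_last_gr a d y : @sg_gr k C 1%N a -> sg_gr d y ->
  sg_gr d (subst_last a y).
Proof.
move=> ga gy; apply: (mmap_gr (C := C) (f := @mpolyC m A)) => //.
  by move=> e x gx; apply: poly_grC.
move=> i; rewrite /last_subst; case: unliftP => [j|] _ /=.
  exact: poly_gr1X.
have [g0 gB] := sg_gr_zmod C 1; rewrite -sub0r; exact: gB.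
Qed.

Lemma subst_last_lift a d (x : C) : sg_gr d x ->
  exists2 y : B, sg_gr d y & subst_last a y = x.
Proof.
move=> gx.
(* The lift is [x] itself, viewed as a polynomial that does not involve the last variable. *)
exists (mmap (@mpolyC m.+1 A) (fun j : 'I_m => 'X_(lift ord_max j)) x).
  apply: (mmap_gr (C := B) (f := @mpolyC m.+1 A)) => //.
    by move=> e z gz; apply: poly_grC.
  by move=> j; apply: poly_gr1X.
rewrite [in RHS](mpolyE x) [X in subst_last _ X]/mmap raddf_sum /=.
apply: eq_bigr => u _; rewrite rmorphM /= mmapC mul_mpolyC; congr (_ *: _).
rewrite -mmap1_id /mmap1 rmorph_prod /=; apply: eq_bigr => i _.
by rewrite rmorphXn /= mmapX mmap1U /last_subst liftK.
Qed.

(** Descent with the one-element family [f]: the coefficient at [u] modulo m_A vanishes on m_B J, as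
    can be tested on products, but equals 1 at [f]. *)
Lemma ms_leq_subst_last a (J : set B) (f : {mpoly A[m.+1]}) (u : 'X_{1..m.+1}) :
  @sg_gr k C 1%N a -> admissible_set J -> J f -> subst_last a f = 0 ->
  (forall y z : {mpoly A[m.+1]}, mB y -> J z -> mA (y * z)@_u) -> f@_u = 1 ->
  (ms C < mu J)%N.
Proof.
move=> ga adJ Jf af Wu fu; rewrite -addn1.
apply: (@ms_leq_descent _ _ _ (subst_last a) _ _ _ J 1%N (fun=> f)) => //.
- by move=> c; rewrite /= mmapC.
- by move=> d y; apply: subst_last_gr.
- exact: subst_last_lift.
have mI := irrelevant_is_ideal A.
apply: free_mod_mcoeff fu.
apply: (@ideal_prod_ind k B _ _ (fun q : {mpoly A[m.+1]} => mA q@_u)) => //.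
  by rewrite mcoeff0; apply: is_ideal0.
by move=> x y hx hy; rewrite mcoeffD; apply: is_idealD.
Qed.

Lemma ms_polyS_gt : (ms C < ms B)%N.
Proof.
have [[J adJ <-] _] := ms_spec B.
have [JI Jhom JmB m2J] := adJ; have mI := irrelevant_is_ideal A.
pose N : 'X_{1..m.+1} := U_(ord_max)%MM.
(* The two cases ask whether the coefficient of X vanishes modulo m_A on all of J; its failure will
   produce a linear form in J that involves X. *)
have [JN|] := EM (forall z : {mpoly A[m.+1]}, J z -> mA z@_N).
  apply: (@ms_leq_subst_last 0 J 'X_[N + N] (N + N)%MM) => //.
  - exact: sg_gr_0.
  - rewrite mpolyXD; apply/m2J/ideal_prodM; apply: (@sg_grS_irrelevant k B 0).
      exact: poly_gr1X.
    exact: poly_gr1X.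
  - rewrite mpolyXD rmorphM /= mmapX mmap1U /last_subst unlift_none /= oppr0.
    by rewrite mul0r.
  - move=> y z /poly_irrelevantE my Jz; apply: mcoeffM_irrelevant => v w vw.
    (* If X^2 = X^v X^w, a trivial factor is handled by the constant coefficients, and otherwise v =
       w = [N], where [JN] applies to the factor in J. *)
    case: (eqVneq v 0%MM) => [->|v0]; first by left.
    case: (eqVneq w 0%MM) => [->|w0].
      by right; apply/poly_irrelevantE/JmB.
    right; suff -> : w = N by apply: JN.
    have := congr1 (@mdeg _) vw; rewrite !mdegD !mdeg1 => dvw.
    have /eqP : mdeg w = 1%N.
      move: v0 w0 dvw; rewrite -!mdeg_eq0.
      by case: (mdeg v) (mdeg w) => [|[|a]] [|[|b]] //=; rewrite !addnS.
    rewrite mdeg_eq1 => /existsP [j /eqP wj]; rewrite wj; congr U_(_)%MM.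
    have := congr1 (fun u : 'X_{1..m.+1} => u j) vw.
    rewrite wj !mnmDE !mnm1E eqxx addn1.
    by case: eqP.
  - by rewrite mcoeffX eqxx.
move=> /existsNP [z /not_implyP [Jz zN]].
have [y [Jy [d gy]] yN] :
    exists2 y : {mpoly A[m.+1]}, (J `&` homogeneous (@sg_gr k B)) y & ~ mA y@_N.
  apply: contrapT => noy; apply: zN; move: (z) (Jhom _ Jz); apply: finite_sums_ind.
  - by rewrite mcoeff0; apply: is_ideal0.
  - by move=> x y hx hy; rewrite mcoeffD; apply: is_idealD.
  by move=> x hx; apply: contrapT => xN; apply: noy; exists x.
(* In degree 0 the coefficient at [N] is zero, and in degree at least 2 it has positive degree;
   either way it would lie in m_A. *)
have d1 : d = 1%N.
  have := gy N; rewrite mdeg1; case: d {gy} => [|[|d]] //= gyN; case: yN.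
    by rewrite gyN; apply: is_ideal0.
  exact: sg_grS_irrelevant gyN.
rewrite {d}d1 in gy.
have [c yc] : exists c, y@_N = sg_emb A c.
  by have := gy N; rewrite mdeg1 subnn sg_gr0 => -[c _ <-]; exists c.
have c0 : c != 0.
  by apply/eqP => c0; apply: yN; rewrite yc c0 rmorph0; apply: is_ideal0.
(* Rescaling makes the coefficient of X equal to 1. *)
pose f : {mpoly A[m.+1]} := (sg_emb A c^-1)%:MP * y.
have fN : f@_N = 1 by rewrite mcoeffCM yc -rmorphM mulVf ?rmorph1.
have gf : @sg_gr k B 1%N f.
  rewrite -[1%N]add0n; apply: (@sg_grM k B) gy; apply: poly_grC.
  by rewrite sg_gr0; exists c^-1.
(* Setting X := 0 leaves the part of [f] without X, so [f] is X plus this form and X := -a kills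
   it. *)
pose a := subst_last 0 f.
have ga : @sg_gr k C 1%N a by apply: subst_last_gr => //; apply: sg_gr_0.
apply: (@ms_leq_subst_last a J f N) => //; first exact: is_idealM.
- have last b : last_subst b ord_max = - b by rewrite /last_subst unlift_none.
  (* [S] collects the contributions of all but the last variable, which are the same for every
     substitution [b]; comparing b = 0 with b = a gives the vanishing. *)
  pose S : {mpoly A[m]} := (f@_0%MM)%:MP +
    \sum_(i < m.+1 | i != ord_max) (f@_U_(i))%:MP * last_subst 0 i.
  have fE b : subst_last b f = - b + S.
    rewrite /= (mmap_gr1 (C := C) (@mpolyC m A) (last_subst b) gf).
    rewrite (bigD1 ord_max) //= fN last mpolyC1 mul1r addrCA.
    congr (_ + (_ + _)); apply: eq_bigr => i im; congr (_ * _).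
    by rewrite /last_subst; case: unliftP im => [j|->] //; rewrite eqxx.
  have aE : a = S by rewrite /a fE oppr0 add0r.
  by rewrite fE -aE addNr.
(* Both factors lie in m_B, and X has degree one, so each term of the coefficient at [N] involves a
   constant coefficient of one factor. *)
move=> x w /poly_irrelevantE mx /JmB /poly_irrelevantE mw.
apply: mcoeffM_irrelevant => u v uv.
case: (eqVneq u 0%MM) => [->|u0]; first by left.
case: (eqVneq v 0%MM) => [->|v0]; first by right.
have := congr1 (@mdeg _) uv; rewrite mdegD mdeg1.
move: u0 v0; rewrite -!mdeg_eq0.
by case: (mdeg u) (mdeg v) => [|a'] [|b] //=; rewrite addnS.
Qed.

End LastVariable.

(** * Induction on the number of adjoined variables *)

Lemma ms_poly (k : fieldType) (A : stdGradedAlg k) m :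
  ms (polySGA A m) = (ms A + m)%N.
Proof.
apply/eqP; rewrite eqn_leq ms_poly_leq /=.
elim: m => [|m IH]; first by rewrite addn0; apply: ms_poly0_geq.
by rewrite addnS; apply: leq_ltn_trans IH (ms_polyS_gt A m).
Qed.

Theorem proposition2p15 (k : fieldType) (t n : nat) (t_gt0 : (0 < t)%N)
  (le_tn : (t <= n)%N) (I : idealr {mpoly k[t]})
  (I_hom : homogeneous_ideal (@mpoly_gr k t) [set` I]%classic) :
  ms (polySGA (quotSGA I_hom) (n - t)) = (ms (quotSGA I_hom) + (n - t))%N.
Proof. exact: ms_poly. Qed.
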